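(* Let $(X,d)$ be a complete metric space and let $Y\subset X$ be a nonempty $G_\delta$ set, $Y=\bigcap_{n=1}^\infty U_n$ with $U_n\subset X$ open. Put $F_n:=X\setminus U_n$ and $\varphi_n(x):=1/d(x,F_n)$ for $x\in U_n$, and define for $x,y\in Y$ $$g(x,y):=d(x,y)+\sum_{n=1}^\infty\frac{|\varphi_n(x)-\varphi_n(y)|}{2^n(1+|\varphi_n(x)-\varphi_n(y)|)}.$$ Let $f:Y\to\mathbb{R}\cup\{+\infty\}$ be a proper and bounded below lower semicontinuous function. Then for each $\varepsilon>0$ there is $x_\varepsilon\in Y$ such that $$f(x)+\varepsilon g(x_\varepsilon,x)\ge f(x_\varepsilon),\quad\forall x\in Y.$$
   Context: $d(x,F)=\inf_{z\in F}d(x,z)$ is the distance from a point to a set, with the convention $d(x,\varnothing)=+\infty$ and $1/(+\infty)=0$. $Y$ carries the topology induced by $d$, and lower semicontinuity of $f$ is with respect to it. Proper means $f$ is not identically $+\infty$. *)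

(* Defs.v *)
From HB Require Import structures.
From mathcomp Require Import all_boot all_order all_algebra.
From mathcomp Require Import all_classical all_reals all_analysis.

Set Implicit Arguments.
Unset Strict Implicit.
Unset Printing Implicit Defensive.

Import Order.TTheory GRing.Theory Num.Theory.
Import numFieldNormedType.Exports.

Local Open Scope classical_set_scope.
Local Open Scope ring_scope.

(* [completeType] requires a distinguished point, so such a space is nonempty. *)
#[short(type="completeMetricType")]
HB.structure Definition CompleteMetric (R : numDomainType) :=
  { T of Metric R T & Complete T }.

(* [edist] is defined from the balls of a pseudometric; on a metric space it is
   the given distance. *)
Lemma edistE (R : realType) (X : metricType R) (x z : X) :
  edist (x, z) = (mdist x z)%:E.
Proof.
apply/eqP; rewrite eq_le; apply/andP; split.
  apply/lee_addgt0Pr => e e0; apply: ereal_inf_lbound.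
  have h : 0 < mdist x z + e by rewrite ltr_wpDl// mdist_ge0.
  exists (mdist x z + e) => //=; split => //.
  by rewrite ballEmdist /= ltrDl.
apply: le_ereal_inf_tmp => _ [r [r0 +] <-] /=.
by rewrite ballEmdist /= lee_fin => /ltW.
Qed.

(* The library's [edist_inf] is d(x, F): on a metric space it is the infimum of
   the distances d(x, z), z in F, taken in \bar R, so that it is +oo when F is
   empty. *)
Lemma edist_infE (R : realType) (X : metricType R) (F : set X) (x : X) :
  edist_inf F x = ereal_inf [set (mdist x z)%:E | z in F].
Proof.
by rewrite /edist_inf; congr ereal_inf; apply: eq_imagel => z _; exact: edistE.
Qed.

Section Gdelta_distance.
Context {R : realType} {X : metricType R}.
Variable U : nat -> set X.

(* The inverse is that of \bar R, where (+oo)^-1 = 0. The value of [phi n]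
   outside [U n] is irrelevant. *)
Definition phi (n : nat) (x : X) : R := fine ((edist_inf (~` U n) x)^-1)%E.

(* In R the notation [\sum_(1 <= n <oo)] is not available (it is the \bar R one);
   this is the limit in R of the partial sums. *)
Definition Gdist (x y : X) : R :=
  mdist x y + \big[+%R/0]_(1 <= n <oo)
    (`|phi n x - phi n y| / (2 ^+ n * (1 + `|phi n x - phi n y|))).

End Gdelta_distance.

(* Main.v *)
(* The function g is a metric on Y for which Y is complete: along a g-Cauchy
   sequence each phi_n stays bounded, so the sequence keeps a positive distance
   to F_n and its d-limit lies in every U_n. The theorem is then Ekeland's
   principle for g, obtained by finding an element of the domain of f that is
   minimal for the order y <= x iff f y + eps * g x y <= f x. A decreasing
   sequence u for this order is g-Cauchy; its limit is a lower bound because f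
   is lower semicontinuous and the closed g-balls are sequentially closed for
   d-convergence in Y. *)
Require Import Defs.
From HB Require Import structures.
From mathcomp Require Import all_boot all_order all_algebra.
From mathcomp Require Import all_classical all_reals all_analysis.
From mathcomp Require Import lra.

Set Implicit Arguments.
Unset Strict Implicit.
Unset Printing Implicit Defensive.

Import Order.TTheory GRing.Theory Num.Theory.
Import numFieldNormedType.Exports.

Local Open Scope classical_set_scope.
Local Open Scope ring_scope.

(* Brezis-Browder ordering principle: each step of a decreasing sequence goes
   within 2^-n of the infimum of h over the elements below the current one, so
   that nothing below a lower bound of the sequence can decrease h. *)
Lemma brezis_browder (R : realType) (T : Type) (D : set T)
    (ord : T -> T -> Prop) (h : T -> R) :
  D !=set0 -> (forall x, ord x x) ->
  (forall x y z, ord x y -> ord y z -> ord x z) ->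
  (forall x y, ord x y -> h x <= h y) ->
  (exists m, forall x, D x -> m <= h x) ->
  (forall u : nat -> T, (forall n, D (u n)) ->
    (forall n m, (n <= m)%N -> ord (u m) (u n)) ->
    exists2 x, D x & forall n, ord x (u n)) ->
  exists2 x, D x & forall y, D y -> ord y x -> h x <= h y.
Proof.
move=> [x0 Dx0] ord_refl ord_trans ord_h [m hm] lbP.
(* [D x] is assumed inside the existential so that choice yields a total function. *)
have step (n : nat) (x : T) : exists y, D x -> [/\ D y, ord y x &
    forall z, D z -> ord z x -> h y <= h z + 2^-1 ^+ n].
  have [Dx|nDx] := pselect (D x); last by exists x.
  pose S := [set h z | z in [set z | D z /\ ord z x]].
  have infS : has_inf S.
    split; first by exists (h x), x.
    by exists m => _ [z [Dz _] <-]; exact: hm.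
  have e0 : 0 < 2^-1 ^+ n :> R by rewrite exprn_gt0.
  have [_ [y [Dy yx] <-] hy] := inf_adherent e0 infS.
  exists y => _; split => // z Dz zx; apply/ltW/(lt_le_trans hy).
  by rewrite lerD2r; apply: ge_inf => //; [exact: infS.2|exists z].
have /choice[F FP] : forall p : nat * T, exists y, D p.2 -> [/\ D y, ord y p.2 &
    forall z, D z -> ord z p.2 -> h y <= h z + 2^-1 ^+ p.1].
  by move=> [n x]; exact: step.
pose u := fix u n := if n is n'.+1 then F (n', u n') else x0.
have Du n : D (u n) by elim: n => //= n IH; have [] := FP (n, u n) IH.
have u_dec n k : (n <= k)%N -> ord (u k) (u n).
  elim: k => [|k IH]; first by rewrite leqn0 => /eqP ->.
  rewrite leq_eqVlt => /predU1P[->//|/IH uk].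
  by have [_ /= ? _] := FP (k, u k) (Du k); exact: ord_trans uk.
have [x Dx xu] := lbP u Du u_dec.
exists x => // y Dy yx; apply/ler_addgt0Pr => e e0.
have /cvgrPdist_lt/(_ _ e0)[n _ /(_ n (leqnn n))] :
    geometric 1 (2^-1 : R) k @[k --> \oo] --> 0.
  by apply: cvg_geometric; rewrite ger0_norm// invf_lt1// ltr1n.
rewrite /= mul1r sub0r normrN ger0_norm ?exprn_ge0// => ne.
(* As [y] is below [u n], the choice of [u n.+1] gives [h x <= h (u n.+1) <= h y + 2^-n]. *)
have [_ _ /(_ y Dy (ord_trans _ _ _ yx (xu n)))/= h1] := FP (n, u n) (Du n).
apply: (le_trans (ord_h _ _ (xu n.+1))).
by apply: (le_trans h1); rewrite lerD2l ltW.
Qed.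

(** * The function [t / (1 + t)] *)

Section damped.
Context {R : realFieldType}.
Implicit Types a b c : R.

Lemma damp_ge0 a : 0 <= a -> 0 <= a / (1 + a).
Proof. by move=> a0; rewrite divr_ge0// addr_ge0. Qed.

Lemma damp_le1 a : 0 <= a -> a / (1 + a) <= 1.
Proof. by move=> a0; rewrite ler_pdivrMr; lra. Qed.

Lemma damp_lt_half a : 0 <= a -> a / (1 + a) < 1 / 2 -> a < 1.
Proof. by move=> a0; rewrite ltr_pdivrMr; lra. Qed.

(** Monotonicity of [t / (1 + t)] reduces this to [c = a + b], where splitting the fraction leaves
    the larger denominator [1 + (a + b)] under each summand. *)
Lemma damp_subadditive a b c : 0 <= a -> 0 <= b -> 0 <= c -> c <= a + b ->
  c / (1 + c) <= a / (1 + a) + b / (1 + b).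
Proof.
move=> a0 b0 c0 cab.
have h : c / (1 + c) <= (a + b) / (1 + (a + b)).
  rewrite ler_pdivrMr; last lra.
  by rewrite mulrAC ler_pdivlMr; nra.
apply: (le_trans h); rewrite mulrDl lerD// ler_wpM2l// lef_pV2 ?posrE; lra.
Qed.

End damped.

(** * The functions [phi n], the distance [g] and its completeness *)

Section Gdelta.
Context {R : realType} {X : metricType R}.
Variable U : nat -> set X.
Implicit Types (n N k : nat) (x y z : X).

(** If the complement of [U n] is empty, both sides vanish, since [fine +oo = 0] and [0^-1 = 0] in
    [R]. *)
Lemma phiE n x : phi U n x = (fine (edist_inf (~` U n) x))^-1.
Proof.
rewrite /phi; move: (edist_inf_neqNy (~` U n) x).
by case: (edist_inf _ _) => [r _|_|//]; rewrite ?fine_invr//= invr0.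
Qed.

Lemma edist_inf_setC_gt0 (V : set X) x : open V -> V x ->
  (0 < edist_inf (~` V) x)%E.
Proof.
rewrite openE => /[apply] /nbhs_ballP[e /= e0 xe].
apply: (@lt_le_trans _ _ e%:E); first by rewrite lte_fin.
rewrite edist_infE; apply: le_ereal_inf_tmp => _ [z nVz <-].
rewrite lee_fin leNgt; apply/negP => xz.
by apply/nVz/xe; rewrite ballEmdist.
Qed.

(** This is the blow-up of [phi n] near points outside [U n]: the distance to the complement is
    positive and at most [mdist x z]. *)
Lemma mdist_phi_ge1 n x z : open (U n) -> U n x -> ~ U n z ->
  1 <= mdist x z * phi U n x.
Proof.
move=> oU Ux nUz; rewrite phiE.
have : (edist_inf (~` U n) x <= (mdist x z)%:E)%E.
  by rewrite edist_infE; apply: ereal_inf_lbound; exists z.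
have := edist_inf_setC_gt0 oU Ux.
case: (edist_inf _ _) => [r| |]//=; rewrite lte_fin lee_fin => r0 rxz.
by rewrite ler_pdivlMr// mul1r.
Qed.

Lemma phi_continuous n x : open (U n) -> U n x ->
  {for x, continuous (phi U n)}.
Proof.
move=> oU Ux.
have -> : phi U n = (fun y => (fine (edist_inf (~` U n) y))^-1).
  by apply/funext => y; exact: phiE.
rewrite /prop_for; have := edist_inf_setC_gt0 oU Ux.
have := @edist_inf_continuous R X (~` U n) x; rewrite /continuous_at.
(* An empty complement makes the distance constantly [+oo]; otherwise it is finite and positive at
   [x], so [fine] and the inverse pass to the limit. *)
have [F0 _ _|/set0P[z Fz]] := eqVneq (~` U n) set0.
  rewrite F0; have -> : edist_inf (@set0 X) = cst +oo%E.
    by apply/funext => y; rewrite edist_infE image_set0 ereal_inf0.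
  exact: cvg_cst.
have : (edist_inf (~` U n) x <= (mdist x z)%:E)%E.
  by rewrite edist_infE; apply: ereal_inf_lbound; exists z.
case: (edist_inf _ x) => [r| |]//= _; rewrite lte_fin => + r0.
by move=> /fine_cvg h; apply: (cvgV _ h); rewrite gt_eqF.
Qed.

Definition Gterm n x y : R :=
  `|phi U n x - phi U n y| / (2 ^+ n * (1 + `|phi U n x - phi U n y|)).

Definition Gpartial N x y : R := mdist x y + \sum_(1 <= n < N) Gterm n x y.

Lemma GtermE n x y : Gterm n x y =
  `|phi U n x - phi U n y| / (1 + `|phi U n x - phi U n y|) / 2 ^+ n.
Proof. by rewrite /Gterm invfM mulrA mulrAC. Qed.

Lemma Gterm_ge0 n x y : 0 <= Gterm n x y.
Proof. by rewrite GtermE divr_ge0 ?damp_ge0// exprn_ge0. Qed.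

#[local] Hint Resolve Gterm_ge0 : core.

Lemma Gterm_triangle n x y z : Gterm n x z <= Gterm n x y + Gterm n y z.
Proof.
rewrite !GtermE -mulrDl ler_wpM2r ?invr_ge0 ?exprn_ge0//.
by rewrite damp_subadditive// ler_distD.
Qed.

Lemma Gpartial_homo x y :
  {homo (fun N => Gpartial N x y) : N M / (N <= M)%N >-> N <= M}.
Proof.
apply/nondecreasing_seqP => N; rewrite lerD2l.
case: N => [|N]; first by rewrite !big_geq.
by rewrite [leRHS]big_nat_recr//= lerDl Gterm_ge0.
Qed.

(** The series in [Gdist] is a [lim], usable only once convergence is known: partial sums increase
    and are dominated by a geometric series. *)
Lemma Gpartial_cvg x y : Gpartial N x y @[N --> \oo] --> Gdist U x y.
Proof.
apply: cvgD; first exact: cvg_cst.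
apply: (@nondecreasing_is_cvgn _ (fun N => \sum_(1 <= n < N) Gterm n x y)).
  by move=> N M /(Gpartial_homo x y); rewrite lerD2l.
exists 1 => _ [N _ <-].
(* The exact geometric sum lets the induction close, which the bound [1] alone would not. *)
suff h : \sum_(1 <= n < N.+1) Gterm n x y <= 1 - 2^-1 ^+ N.
  have := Gpartial_homo x y (leqnSn N); rewrite lerD2l => /le_trans; apply.
  by apply: (le_trans h); rewrite gerBl exprn_ge0.
elim: N => [|N IH]; first by rewrite big_geq// expr0 subrr.
rewrite big_nat_recr//=.
have : Gterm N.+1 x y <= 2^-1 ^+ N.+1.
  by rewrite GtermE -exprVn ler_piMl ?exprn_ge0// damp_le1.
move: IH; rewrite exprS; lra.
Qed.

Lemma Gpartial_le N x y : Gpartial N x y <= Gdist U x y.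
Proof.
apply: (cvgr_to_ge (@Gpartial_cvg x y)); near=> M.
apply: Gpartial_homo; near: M; exact: nbhs_infty_ge.
Unshelve. all: by end_near. Qed.

Lemma Gdist_ge0 x y : 0 <= Gdist U x y.
Proof.
by apply: le_trans (Gpartial_le 0 x y); rewrite addr_ge0 ?mdist_ge0// sumr_ge0.
Qed.

Lemma mdist_le_Gdist x y : mdist x y <= Gdist U x y.
Proof. by have := Gpartial_le 0 x y; rewrite /Gpartial big_geq// addr0. Qed.

Lemma Gterm_le_Gdist n x y : (0 < n)%N -> Gterm n x y <= Gdist U x y.
Proof.
move=> n0; apply: le_trans (Gpartial_le n.+1 x y).
by rewrite /Gpartial big_nat_recr//= addrA lerDr addr_ge0 ?mdist_ge0// sumr_ge0.
Qed.

Lemma Gdistxx x : Gdist U x x = 0.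
Proof.
apply: (cvg_unique (@Rhausdorff R) (@Gpartial_cvg x x)).
have -> : (fun N => Gpartial N x x) = cst 0.
  apply/funext => N; rewrite /Gpartial mdistxx add0r big1// => n _.
  by rewrite /Gterm subrr normr0 mul0r.
exact: cvg_cst.
Qed.

Lemma Gdist_triangle x y z : Gdist U x z <= Gdist U x y + Gdist U y z.
Proof.
apply: (ler_cvg_to (@Gpartial_cvg x z)).
  exact: cvgD (@Gpartial_cvg x y) (@Gpartial_cvg y z).
apply: nearW => N; rewrite /= fctE /Gpartial addrACA -big_split/=.
by rewrite lerD ?metric_triangle// ler_sum// => n _; exact: Gterm_triangle.
Qed.

Lemma mdist_cvg (u : nat -> X) x y :
  u n @[n --> \oo] --> x -> mdist y (u n) @[n --> \oo] --> mdist y x.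
Proof.
move=> ux; apply/cvgrPdist_lt => e e0.
have /cvg_ballP/(_ e e0) := ux; apply: filterS => n.
rewrite ballEmdist /= => /le_lt_trans; apply.
rewrite ler_norml; have := metric_triangle y x (u n).
have := metric_triangle y (u n) x; rewrite (metric_sym (u n)).
by move=> ? ?; apply/andP; split; lra.
Qed.

Hypothesis openU : forall n, (0 < n)%N -> open (U n).

(** For fixed [N] the partial sum is continuous at [x] in its second argument, so the bound [c]
    passes to [x]; then [N] tends to infinity. *)
Lemma Gdist_closed_ball (u : nat -> X) x y c :
  (forall n, (0 < n)%N -> U n x) -> u n @[n --> \oo] --> x ->
  (\forall n \near \oo, Gdist U y (u n) <= c) -> Gdist U y x <= c.
Proof.
move=> Ux ux uc; apply: (cvgr_to_le (@Gpartial_cvg y x)).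
apply: nearW => N.
have cvgN : Gpartial N y (u m) @[m --> \oo] --> Gpartial N y x.
  apply: cvgD; first exact: mdist_cvg.
  rewrite big_nat; under eq_cvg do rewrite big_nat.
  apply: cvg_big => [|n /andP[n0 _]]; first exact: add_continuous.
  have h : `|phi U n y - phi U n (u m)| @[m --> \oo] -->
      `|phi U n y - phi U n x|.
    apply: cvg_norm; apply: cvgB; first exact: cvg_cst.
    by apply: continuous_cvg => //; apply: phi_continuous; [exact: openU|exact: Ux].
  apply: cvgM => //; apply: cvgV.
    by rewrite mulf_neq0 ?expf_neq0// gt_eqF// ltr_pwDl.
  apply: cvgM; first exact: cvg_cst.
  by apply: cvgD => //; exact: cvg_cst.
apply: (cvgr_to_le cvgN); apply: filterS uc => m.
exact/le_trans/Gpartial_le.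
Qed.

End Gdelta.

Lemma Gdist_complete (R : realType) (X : completeMetricType R)
    (U : nat -> set X) (u : nat -> X) :
  (forall n, (0 < n)%N -> open (U n)) ->
  (forall m n, (0 < n)%N -> U n (u m)) ->
  (forall e, 0 < e -> exists N, forall m, (N <= m)%N ->
    Gdist U (u N) (u m) < e) ->
  exists2 x, (forall n, (0 < n)%N -> U n x) & u n @[n --> \oo] --> x.
Proof.
move=> openU Uu cau.
have /cauchy_cvg/cvg_ex[x ux] : cauchy (u n @[n --> \oo]).
  apply: cauchy_exP => e e0; have [N hN] := cau e e0.
  exists (u N); exists N => // m /= Nm; rewrite /= ballEmdist /=.
  exact: le_lt_trans (mdist_le_Gdist _ _ _) (hN m Nm).
exists x => // n n0; apply: contrapT => nUx.
(* An [n]-th term below this constant forces [phi n (u m)] to stay within [1] of [phi n (u N)],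
   whence the bound [C]. Terms closer than [C^-1] to [x] then contradict [mdist_phi_ge1]. *)
have e0 : 0 < 1 / 2 / 2 ^+ n :> R by rewrite !divr_gt0// exprn_gt0.
have [N hN] := cau _ e0.
have [C C0 phiC] : exists2 C, 0 < C & forall m, (N <= m)%N -> phi U n (u m) <= C.
  exists (`|phi U n (u N)| + 1); first by rewrite ltr_pwDr.
  move=> m /hN /(le_lt_trans (Gterm_le_Gdist _ _ _ n0)).
  rewrite GtermE ltr_pM2r ?invr_gt0 ?exprn_gt0// => /damp_lt_half.
  move=> /(_ (normr_ge0 _)); rewrite ltr_norml => /andP[h _].
  by have := ler_norm (phi U n (u N)); lra.
have /cvg_ballP/(_ C^-1) := ux; rewrite invr_gt0 => /(_ C0)[M _ hM].
have /hM := leq_maxl M N; rewrite /= ballEmdist /= metric_sym => lt1.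
have := mdist_phi_ge1 (openU _ n0) (Uu (maxn M N) n n0) nUx.
apply/negP; rewrite -ltNge.
apply: (@le_lt_trans _ _ (mdist (u (maxn M N)) x * C)).
  by rewrite ler_wpM2l ?mdist_ge0// phiC// leq_maxr.
by rewrite -ltr_pdivlMr// mul1r.
Qed.

(** This transfers convergence obtained in [X] to the topology of [Y], in which [f] is lower
    semicontinuous. *)
Lemma nbhs_set_val_cvg (T : topologicalType) (Y : set T) (u : nat -> Y) (x : Y)
    (V : set Y) :
  set_val (u n) @[n --> \oo] --> set_val x -> nbhs x V ->
  \forall n \near \oo, V (u n).
Proof.
move=> ux [_ [[A oA <-] /= Ax] sAV].
have uA : \forall n \near \oo, A (set_val (u n)).
  by apply: ux; exact: open_nbhs_nbhs.
by apply: filterS uA => n; exact: sAV.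
Qed.

(** * Ekeland's principle for [g] *)

Local Open Scope ereal_scope.

Theorem corollary5p4 (R : realType) (X : completeMetricType R)
    (U : nat -> set X) (Y : set X)
    (openU : forall n, (1 <= n)%N -> open (U n))
    (YE : Y = \bigcap_(n >= 1) U n)
    (Y0 : Y !=set0)
    (f : Y -> \bar R)
    (f_notNy : forall x : Y, f x != -oo)
    (f_proper : ~ (forall x : Y, f x = +oo))
    (f_lb : exists m : R, forall x : Y, m%:E <= f x)
    (f_lsc : lower_semicontinuous f)
    (eps : R) (eps_gt0 : (0 < eps)%R) :
  exists xeps : Y, forall x : Y,
    f x + (eps * Gdist U (set_val xeps) (set_val x))%:E >= f xeps.
Proof.
have YU (x : Y) n : (0 < n)%N -> U n (set_val x).
  by move=> n0; have : Y `<=` U n; [rewrite YE => z; exact|apply; exact: set_valP].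
have [m f_ge_m] := f_lb.
have finP x : f x < +oo -> f x \is a fin_num.
  by rewrite fin_numE f_notNy => /lt_eqF ->.
(* [h] represents [f] only on [D]: where [f] is [+oo], [fine] returns [0]. *)
pose D := [set x | f x \is a fin_num].
pose h x := fine (f x).
pose g (x y : Y) := Gdist U (set_val x) (set_val y).
pose ord y x := (h y + eps * g x y <= h x)%R.
have fh x : D x -> f x = (h x)%:E by move=> Dx; rewrite /h fineK.
have eg_ge0 x y : (0 <= eps * g x y)%R by rewrite mulr_ge0 ?Gdist_ge0// ltW.
have ord_h x y : ord x y -> (h x <= h y)%R.
  by apply: le_trans; rewrite lerDl.
have [||x y z xy yz||||x Dx xmin] := @brezis_browder R Y D ord h.
- have /existsNP[x /eqP fx] := f_proper.
  by exists x; apply: finP; rewrite ltey.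
- by move=> x; rewrite /ord /g Gdistxx mulr0 addr0.
- have := Gdist_triangle U (set_val z) (set_val y) (set_val x).
  rewrite -(ler_pM2l eps_gt0) [leRHS]mulrDr.
  by move: xy yz; rewrite /ord /g; lra.
- exact: ord_h.
- by exists m => x Dx; rewrite -lee_fin -fh.
- move=> u Du u_dec.
  (* [h (u n) - L] bounds [eps * g] from [u n] to all later terms; this gives both the Cauchy
     property and the estimate at the limit. *)
  pose L := inf (range (h \o u)).
  have infh : has_inf (range (h \o u)).
    split; first by exists (h (u 0%N)), 0%N.
    by exists m => _ [n _ <-]; rewrite -lee_fin -fh.
  have L_le n : (L <= h (u n))%R by apply: ge_inf; [exact: infh.2|exists n].
  have g_le n k : (n <= k)%N -> (eps * g (u n) (u k) <= h (u n) - L)%R.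
    by move=> /u_dec; have := L_le k; rewrite /ord; lra.
  have [|e e0|x Ux ux] := @Gdist_complete R X U (set_val \o u) openU.
  + by move=> k n; exact: YU.
  + have [_ [N _ <-] /= hN] := inf_adherent (mulr_gt0 eps_gt0 e0) infh.
    exists N => k /g_le geN; rewrite -(ltr_pM2l eps_gt0).
    by apply: (le_lt_trans geN); rewrite ltrBlDl.
  have Yx : x \in Y by rewrite inE YE => n /= n0; exact: Ux.
  pose y : Y := SigSub Yx.
  (* If [L + e < f y], lower semicontinuity keeps [f (u k)] above [L + e] for large [k], while
     [h (u k)] decreases to [L]. *)
  have fy : f y <= L%:E.
    apply/lee_addgt0Pr => e e0; rewrite leNgt -EFinD; apply/negP.
    move=> /f_lsc[V Vy hV].
    have [M _ hM] := @nbhs_set_val_cvg _ _ u y _ ux Vy.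
    have [_ [N _ <-] /= hN] := inf_adherent e0 infh.
    have /hM/hV := leq_maxl M N; rewrite fh// lte_fin; apply/negP.
    rewrite -leNgt ltW//; apply: le_lt_trans hN.
    by apply: ord_h; apply: u_dec; exact: leq_maxr.
  have Dy : D y by apply: finP; exact: le_lt_trans fy (ltry _).
  exists y => // n; rewrite /ord.
  have hy : (h y <= L)%R by rewrite -lee_fin -fh.
  (* The tail of [u] lies in the closed [g]-ball of this radius around [u n], hence so does [y]. *)
  suff : (g (u n) y <= (h (u n) - L) / eps)%R.
    by rewrite ler_pdivlMr// mulrC; lra.
  apply: (Gdist_closed_ball openU Ux ux).
  exists n => // k /g_le; rewrite /g /=.
  by rewrite ler_pdivlMr// mulrC.
- exists x => y.
  have [fy|] := ltP (f y) +oo; last first.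
    by rewrite leye_eq => /eqP ->; rewrite addye// leey.
  have Dy := finP _ fy.
  (* A violation gives [ord y x], so [h x <= h y] by minimality, against
     [h y <= h y + eps * g x y < h x]. *)
  rewrite !fh// -EFinD lee_fin leNgt; apply/negP => lt_yx.
  have := xmin y Dy (ltW lt_yx); apply/negP; rewrite -ltNge.
  by apply: le_lt_trans lt_yx; rewrite lerDl eg_ge0.
Qed.
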